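(* For every $\mu\in[\mu_0,\delta^{-1}]$, the function $P_\mu^d$ of the two real variables $(\varsigma,\sigma)$ is concave on $\mathcal S_\mu^+$.
   Context: Data: $n,m\ge 1$; $B\in\mathbb R^{m\times n}$; $Q\in\mathbb R^{n\times n}$ symmetric; $H\in\mathbb R^{n\times n}$ (symmetric) negative definite; $\lambda\in\mathbb R$, $\lambda>0$; $f,b\in\mathbb R^n$. Define $h(x)=\tfrac12x^THx-b^Tx$ for $x\in\mathbb R^n$. Assume $h(H^{-1}b)>0$, define $\mu_0>0$ by $\mu_0^{-1}=h(H^{-1}b)$, and fix $\delta\in(0,\mu_0^{-1}]$. For $\mu\in[\mu_0,\delta^{-1}]$ let $$G_\mu(\varsigma,\sigma)=Q+\mu\varsigma B^TB-\sigma H,\qquad \mathcal S_\mu^+=\{(\varsigma,\sigma)\in\mathbb R^2:\varsigma\ge-\lambda,\ \sigma\ge0,\ G_\mu(\varsigma,\sigma)\succ0\},$$ where $\succ0$ means positive definite, and for $(\varsigma,\sigma)\in\mathcal S_\mu^+$ let $$P_\mu^d(\varsigma,\sigma)=-\tfrac12(f-\sigma b)^TG_\mu(\varsigma,\sigma)^{-1}(f-\sigma b)-\mu\lambda\varsigma-\tfrac{\mu}{2}\varsigma^2+\tfrac{\sigma}{\mu}.$$ *)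

(* Defs.v *)
From HB Require Import structures.
From mathcomp Require Import all_boot all_order all_algebra.
From mathcomp Require Import all_classical all_reals all_analysis.

Set Implicit Arguments.
Unset Strict Implicit.
Unset Printing Implicit Defensive.

Import Order.TTheory GRing.Theory Num.Theory.

Local Open Scope classical_set_scope.
Local Open Scope ring_scope.

Definition qform (R : realType) (n : nat) (A : 'M[R]_n) (x : 'cV[R]_n) : R :=
  (x^T *m A *m x) 0 0.

(* Definiteness includes symmetry. *)
Definition posdefmx (R : realType) (n : nat) (A : 'M[R]_n) : Prop :=
  A^T = A /\ forall x : 'cV[R]_n, x != 0 -> 0 < qform A x.

Definition negdefmx (R : realType) (n : nat) (A : 'M[R]_n) : Prop :=
  A^T = A /\ forall x : 'cV[R]_n, x != 0 -> qform A x < 0.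

(* Concavity on D includes convexity of D: [convex_function] alone also makes
   sense on a non-convex D. *)
Definition concave_on (R : realType) (E : lmodType R)
    (D : set (convex_lmodType E)) (F : E -> R) : Prop :=
  convex_set D /\ convex_function D (fun x => - F x).

Definition hfun (R : realType) (n : nat) (H : 'M[R]_n) (b x : 'cV[R]_n) : R :=
  2^-1 * qform H x - (b^T *m x) 0 0.

Definition Gmat (R : realType) (m n : nat) (B : 'M[R]_(m, n)) (Q H : 'M[R]_n)
    (mu vs s : R) : 'M[R]_n :=
  Q + (mu * vs) *: (B^T *m B) - s *: H.

(* R^o * R^o is R^2 with its canonical vector space structure; the first
   component is varsigma, the second one is sigma. *)
Definition Splus (R : realType) (m n : nat) (B : 'M[R]_(m, n)) (Q H : 'M[R]_n)
    (lam mu : R) : set (R^o * R^o) :=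
  [set p | [/\ - lam <= p.1, 0 <= p.2 & posdefmx (Gmat B Q H mu p.1 p.2)]].

Definition Pdual (R : realType) (m n : nat) (B : 'M[R]_(m, n)) (Q H : 'M[R]_n)
    (f b : 'cV[R]_n) (lam mu : R) (p : R^o * R^o) : R :=
  let vs : R := p.1 in
  let s : R := p.2 in
  - (2^-1 * qform (invmx (Gmat B Q H mu vs s)) (f - s *: b))
  - mu * lam * vs - mu / 2 * vs ^+ 2 + s / mu.

(* Main.v *)
(* For positive definite [A], [v^T A^-1 v] is the maximum over [x] of
   [2 v^T x - x^T A x], which is affine in [(A, v)]; hence [v^T A^-1 v] is
   jointly convex in [(A, v)]. Since [Gmat] and [f - sigma b] are affine in
   [(varsigma, sigma)], the first term of [Pdual] is concave,
   and the other terms are concave because [0 < mu]. *)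
Require Import Defs.
From mathcomp Require Import all_boot all_order all_algebra.
From mathcomp Require Import all_classical all_reals all_analysis.
From mathcomp Require Import ring lra.
Import Order.TTheory GRing.Theory Num.Theory.
Local Open Scope ring_scope.

Lemma qform_comb (R : realType) (n : nat) (a c : R) (A C : 'M[R]_n)
    (x : 'cV[R]_n) :
  qform (a *: A + c *: C) x = a * qform A x + c * qform C x.
Proof.
by rewrite /qform mulmxDr mulmxDl -!scalemxAr -!scalemxAl !mxE.
Qed.

(** A row [k] of the left kernel satisfies [k *m A = 0], so the form vanishes at [k^T]; positivity
    then forces [k = 0]. *)
Lemma posdefmx_unit (R : realType) (n : nat) (A : 'M[R]_n) :
  posdefmx A -> A \in unitmx.
Proof.
move=> [symA posA]; rewrite -row_free_unit -kermx_eq0.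
apply/eqP/row_matrixP => i; rewrite row0.
apply: trmx_inj; rewrite trmx0; apply/eqP; apply: contraT => /posA.
have /sub_kermxP kA : (row i (kermx A) <= kermx A)%MS by exact: row_sub.
by rewrite /qform trmxK kA mul0mx mxE ltxx.
Qed.

Lemma posdefmx_conv (R : realType) (n : nat) (t : R) (A C : 'M[R]_n) :
  0 <= t <= 1 -> posdefmx A -> posdefmx C ->
  posdefmx (t *: A + (1 - t) *: C).
Proof.
move=> /andP[t0 t1] [symA posA] [symC posC]; split.
  by rewrite linearD !linearZ /= symA symC.
move=> x x0; rewrite qform_comb.
(* The weights are nonnegative with sum 1, so at least one is positive and the inequality stays
   strict. *)
have := posA x x0; have := posC x x0; nra.
Qed.

Lemma qform_complete_square (R : realType) (n : nat) (A : 'M[R]_n)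
    (v x : 'cV[R]_n) : A^T = A -> A \in unitmx ->
  qform A (x - invmx A *m v) =
  qform A x - 2 * (v^T *m x) 0 0 + qform (invmx A) v.
Proof.
move=> symA uA.
(* A 1 by 1 matrix equals its transpose, so the two cross terms of the expansion merge. *)
have vx : (x^T *m v) 0 0 = (v^T *m x) 0 0
  by rewrite -[x^T *m v]trmxK trmx_mul trmxK mxE.
have subE (X Y : 'M[R]_1) : (X - Y) 0 0 = X 0 0 - Y 0 0 by rewrite !mxE.
rewrite /qform [(_ - _)^T]linearB /= trmx_mul trmx_inv symA.
rewrite mulmxBl !mulmxBr !mulmxBl -!mulmxA !(mulKVmx uA, mulKmx uA) !subE vx; ring.
Qed.

(** The gap between the two sides is the form of [A] at [x - invmx A *m v], hence nonnegative. *)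
Lemma qform_invmx_ge (R : realType) (n : nat) (A : 'M[R]_n)
    (v x : 'cV[R]_n) : posdefmx A ->
  2 * (v^T *m x) 0 0 - qform A x <= qform (invmx A) v.
Proof.
move=> pA; have [symA posA] := pA.
have := @qform_complete_square _ _ A v x symA (@posdefmx_unit _ _ _ pA).
have [->|/posA] := eqVneq (x - invmx A *m v) 0.
  by rewrite {1}/qform mulmx0 mxE; lra.
by lra.
Qed.

Lemma qform_invmx_conv (R : realType) (n : nat) (t : R) (A C : 'M[R]_n)
    (v w : 'cV[R]_n) : 0 <= t <= 1 -> posdefmx A -> posdefmx C ->
  qform (invmx (t *: A + (1 - t) *: C)) (t *: v + (1 - t) *: w) <=
  t * qform (invmx A) v + (1 - t) * qform (invmx C) w.
Proof.
move=> t01 pA pC; have pM := @posdefmx_conv _ _ _ _ _ t01 pA pC.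
(* This [x] is the maximizer for the combined pair [(M, u)], where the lower bound is attained.
   Testing the same [x] against [(A, v)] and [(C, w)] and averaging gives the claim. *)
set M := _ + _ in pM *; set u := _ + _; set x := invmx M *m u.
have := @qform_complete_square _ _ M u x pM.1 (@posdefmx_unit _ _ _ pM).
rewrite subrr {1}/qform mulmx0 mxE /M qform_comb -/M.
have -> : (u^T *m x) 0 0 = t * (v^T *m x) 0 0 + (1 - t) * (w^T *m x) 0 0.
  by rewrite /u linearD !linearZ /= mulmxDl -!scalemxAl !mxE.
have := @qform_invmx_ge _ _ A v x pA; have := @qform_invmx_ge _ _ C w x pC.
case/andP: t01; nra.
Qed.

Lemma Gmat_conv (R : realType) (m n : nat) (B : 'M[R]_(m, n)) (Q H : 'M[R]_n)
    (mu t vs1 vs2 s1 s2 : R) :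
  Gmat B Q H mu (t * vs1 + (1 - t) * vs2) (t * s1 + (1 - t) * s2) =
  t *: Gmat B Q H mu vs1 s1 + (1 - t) *: Gmat B Q H mu vs2 s2.
Proof. by rewrite /Gmat; apply/matrixP => i j; rewrite !mxE; ring. Qed.

Lemma Pdual_conv (R : realType) (m n : nat) (B : 'M[R]_(m, n))
    (Q H : 'M[R]_n) (f b : 'cV[R]_n) (lam mu t vs1 vs2 s1 s2 : R) :
  0 <= t <= 1 -> 0 < mu ->
  posdefmx (Gmat B Q H mu vs1 s1) -> posdefmx (Gmat B Q H mu vs2 s2) ->
  t * Pdual B Q H f b lam mu (vs1, s1) +
    (1 - t) * Pdual B Q H f b lam mu (vs2, s2) <=
  Pdual B Q H f b lam mu (t * vs1 + (1 - t) * vs2, t * s1 + (1 - t) * s2).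
Proof.
move=> t01 mu_gt0 pG1 pG2; rewrite /Pdual /=.
have -> : f - (t * s1 + (1 - t) * s2) *: b =
    t *: (f - s1 *: b) + (1 - t) *: (f - s2 *: b).
  by apply/matrixP => i j; rewrite !mxE; ring.
have := @qform_invmx_conv _ _ _ _ _ (f - s1 *: b) (f - s2 *: b) t01 pG1 pG2.
rewrite -Gmat_conv; case/andP: t01 => t0 t1.
set q := qform _ _; set q1 := qform _ _; set q2 := qform _ _ => leq.
rewrite -subr_ge0; set d := (X in 0 <= X).
(* The affine terms cancel; the squares leave [t * a^2 + (1 - t) * c^2 - (t * a + (1 - t) * c)^2 = t
   * (1 - t) * (a - c)^2]. *)
have -> : d = 2^-1 * (t * q1 + (1 - t) * q2 - q) +
    mu / 2 * (t * (1 - t) * (vs1 - vs2) ^+ 2).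
  by rewrite /d; field; rewrite gt_eqF.
have tt_ge0 : 0 <= t * (1 - t) by rewrite mulr_ge0 ?subr_ge0.
have sq_ge0 := mulr_ge0 tt_ge0 (sqr_ge0 (vs1 - vs2)).
by apply: addr_ge0; apply: mulr_ge0 => //; lra.
Qed.

Theorem lemma2 (R : realType) (n m : nat) (hn : (0 < n)%N) (hm : (0 < m)%N)
    (B : 'M[R]_(m, n)) (Q H : 'M[R]_n) (lam : R) (f b : 'cV[R]_n)
    (hQ : Q^T = Q) (hH : negdefmx H) (hlam : 0 < lam)
    (hpos : 0 < hfun H b (invmx H *m b))
    (mu0 : R) (hmu0_gt0 : 0 < mu0)
    (hmu0 : mu0^-1 = hfun H b (invmx H *m b))
    (delta : R) (hdelta_gt0 : 0 < delta) (hdelta : delta <= mu0^-1)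
    (mu : R) (hmu_ge : mu0 <= mu) (hmu_le : mu <= delta^-1) :
  concave_on (Splus B Q H lam mu) (Pdual B Q H f b lam mu).
Proof.
have mu_gt0 : 0 < mu by exact: lt_le_trans hmu_ge.
(* The first goal is convexity of the domain, the second the inequality for the negated function. *)
split=> [[vs1 s1] [vs2 s2] t | t [vs1 s1] [vs2 s2]].
all: have t01 : 0 <= t%:num <= 1 by rewrite ge0 le1.
all: have /andP[t0 t1] := t01.
all: rewrite !inE => -[/= lo1 hi1 pG1] [/= lo2 hi2 pG2].
  have lo : - lam <= t%:num * vs1 + (1 - t%:num) * vs2 by nra.
  have hi : 0 <= t%:num * s1 + (1 - t%:num) * s2 by nra.
  by split => //; rewrite Gmat_conv; exact: posdefmx_conv.
rewrite convRE 2!mulrN -opprD lerN2.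
exact: (@Pdual_conv _ _ _ _ _ _ f b lam _ _ _ _ _ _ t01 mu_gt0 pG1 pG2).
Qed.
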